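(* Let $\Bbbk$ be an algebraically closed field of characteristic $0$, $G$ a finite abelian group, $A=\mathrm{Hom}(G,\Bbbk^\times)$, and let $\beta:G\times G\to\Bbbk^\times$ be a commutation factor. Let $R_\beta\in \Bbbk A\otimes\Bbbk A$ be the triangular structure associated with $\beta$, let $K\le A$, $G'$, $\beta'$ be the objects attached to $\beta$ in the context, let $\gamma'$ be a normalized 2-cocycle on $G'$ with $\beta'(\overline g,\overline h)=\gamma'(\overline g,\overline h)/\gamma'(\overline h,\overline g)$ for all $\overline g,\overline h\in G'$, and let $J_{\gamma'}=\sum_{\overline g,\overline h\in G'}\gamma'(\overline g,\overline h)\,v_{\overline g}\otimes v_{\overline h}\in \Bbbk K\otimes\Bbbk K$. Then the data associated with the triangular semisimple Hopf algebra $(\Bbbk A,R_\beta)$ in the Etingof–Gelaki classification is $(A,K,J_{\gamma'})$. That is, $J_{\gamma'}$ is a minimal twist for $\Bbbk K$, and, with $u$ the Drinfeld element of $(\Bbbk A,R_\beta)$ and $\widetilde R_\beta=R_\beta (R_\beta)_u$, the triangular Hopf algebras $(\Bbbk A,\widetilde R_\beta)$ and $\big((\Bbbk A)^{J_{\gamma'}},(J_{\gamma'})_{21}^{-1}J_{\gamma'}\big)$ are isomorphic.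
   Context: A commutation factor on $G$ is a bicharacter $\beta:G\times G\to\Bbbk^\times$ (multiplicative in each variable) with $\beta(g,h)\beta(h,g)=1$ for all $g,h\in G$. Let $(e_a)_{a\in A}$ be the canonical basis of $\Bbbk A$. For $g\in G$ put $v_g=\frac1{|G|}\sum_{a\in A}a(g^{-1})e_a\in\Bbbk A$; the map $\delta_g\mapsto v_g$ is a Hopf algebra isomorphism from the algebra $\Bbbk^G$ of functions on $G$ (with basis of delta functions $\delta_g$) onto $\Bbbk A$. Set $R_\beta=\sum_{g,h\in G}\beta(g,h)\,v_g\otimes v_h$. Its Drinfeld element $u\in\Bbbk A\simeq\Bbbk^G$ is the function $u(g)=\beta(g,g)$, with $u(g)\in\{1,-1\}$. For a triangular semisimple Hopf algebra $(B,R)$ with Drinfeld element $u$, set $R_u=\frac12(1\otimes1+1\otimes u+u\otimes1-u\otimes u)$ and $\widetilde R=RR_u$. (Etingof–Gelaki) There exist a finite group $\mathcal L$, a subgroup $\mathcal K\le \mathcal L$ and a minimal twist $J\in\Bbbk \mathcal K\otimes\Bbbk \mathcal K$ such that $(B,\widetilde R)\simeq((\Bbbk \mathcal L)^J,J_{21}^{-1}J)$ as triangular Hopf algebras, and the triple $(\mathcal L,\mathcal K,J)$, called the data associated with $(B,R)$, is unique up to group isomorphism and gauge equivalence of twists. Here $(\Bbbk \mathcal L)^J$ denotes the twist of $\Bbbk \mathcal L$ by $J$, and a twist $J$ for $\Bbbk \mathcal K$ is minimal if the triangular Hopf algebra $((\Bbbk \mathcal K)^J,J_{21}^{-1}J)$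 is minimal. Let $\kappa:G\times G\to\Bbbk^\times$ be $\kappa(g,h)=-1$ if $u(g)=u(h)=-1$ and $\kappa(g,h)=1$ otherwise. Then $\beta\kappa$ is a commutation factor on $G$. Let $\overline\chi:G\to A$, $\overline\chi_g(h)=\beta(g,h)\kappa(g,h)$, and set $K=\{a\in A: a|_{\ker\overline\chi}=1\}$, which is identified with the group of characters of $G'=G/\ker\overline\chi$. Let $\beta'$ be the non-degenerate bicharacter on $G'$ induced by $\beta\kappa$; it satisfies $\beta'(\overline g,\overline g)=1$ for all $\overline g\in G'$, so a cocycle $\gamma'$ as in the claim exists. For $\overline g\in G'$, $v_{\overline g}=\frac1{|G'|}\sum_{a\in K}a(\overline g^{-1})e_a\in\Bbbk K$. *)

(* Defs.v *)
From HB Require Import structures.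
From mathcomp Require Import all_boot all_order all_algebra.
From mathcomp Require Import all_fingroup all_solvable all_field.

Set Implicit Arguments.
Unset Strict Implicit.
Unset Printing Implicit Defensive.

Import GRing.Theory VectorInternalTheory.
Local Open Scope ring_scope.

(* The tensor product of two finite-dimensional vector spaces, realised as the
   matrices of coordinates in the bases underlying [v2r]. *)
Definition tensor (F : fieldType) (U V : vectType F) : Type :=
  'M[F]_(dim U, dim V).

HB.instance Definition _ (F : fieldType) (U V : vectType F) :=
  Vector.copy (tensor U V) 'M[F]_(dim U, dim V).

Definition ptens (F : fieldType) (U V : vectType F) (u : U) (v : V) :
  tensor U V := (v2r u)^T *m v2r v.

Notation "u \ot v" := (ptens u v) (at level 40, left associativity).

Definition bvec (F : fieldType) (U : vectType F) (i : 'I_(dim U)) : U :=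
  r2v (delta_mx 0 i).

(* For f bilinear, [tlift f] is the linear map such that
   [tlift f (u \ot v) = f u v]; see [tliftE]. *)
Definition tlift (F : fieldType) (U V W : vectType F) (f : U -> V -> W)
    (X : tensor U V) : W :=
  \sum_i \sum_j X i j *: f (bvec i) (bvec j).

Section TensorTheory.
Variables (F : fieldType) (U V : vectType F).

Definition bilin (W : vectType F) (f : U -> V -> W) : Prop :=
  (forall v, linear (f^~ v)) /\ (forall u, linear (f u)).

Lemma ptens_bilin : bilin (@ptens F U V).
Proof.
split=> [v a x y|u a x y]; rewrite /ptens.
  by rewrite linearP linearP /= mulmxDl -scalemxAl.
by rewrite linearP mulmxDr -scalemxAr.
Qed.

Lemma bvec_sum (W : vectType F) (u : W) : u = \sum_i v2r u 0 i *: bvec i.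
Proof.
apply: (can_inj (@v2rK _ W)); rewrite linear_sum [LHS]row_sum_delta.
by apply: eq_bigr => i _; rewrite linearZ /= r2vK.
Qed.

Lemma bilin_sum (W : vectType F) (f : U -> V -> W) u v : bilin f ->
  f u v = \sum_i \sum_j (v2r u 0 i * v2r v 0 j) *: f (bvec i) (bvec j).
Proof.
case=> f1 f2.
pose h1 v : {linear U -> W} :=
  HB.pack_for {linear U -> W} (f^~ v)
    (GRing.isLinear.Build _ _ _ _ (f^~ v) (f1 v)).
pose h2 u : {linear V -> W} :=
  HB.pack_for {linear V -> W} (f u)
    (GRing.isLinear.Build _ _ _ _ (f u) (f2 u)).
rewrite {1}(bvec_sum u) -[LHS]/(h1 v _) linear_sum; apply: eq_bigr => i _.
rewrite linearZ /= {1}(bvec_sum v) -[f _ _]/(h2 (bvec i) _) linear_sum.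
rewrite scaler_sumr; apply: eq_bigr => j _.
by rewrite linearZ /= scalerA.
Qed.

Lemma tliftE (W : vectType F) (f : U -> V -> W) u v :
  bilin f -> tlift f (u \ot v) = f u v.
Proof.
move=> bf; rewrite (bilin_sum u v bf); apply: eq_bigr => i _.
apply: eq_bigr => j _; congr (_ *: _).
by rewrite mxE big_ord1 mxE.
Qed.

Lemma tlift_linear (W : vectType F) (f : U -> V -> W) : linear (tlift f).
Proof.
move=> a X Y; rewrite /tlift scaler_sumr -big_split; apply: eq_bigr => i _ /=.
rewrite scaler_sumr -big_split; apply: eq_bigr => j _ /=.
by rewrite !mxE scalerDl scalerA.
Qed.

HB.instance Definition _ (W : vectType F) (f : U -> V -> W) :=
  GRing.isLinear.Build F (tensor U V) W _ (tlift f) (tlift_linear f).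

Lemma tlift_linear_fun (W : vectType F) (f g h : U -> V -> W) x X :
  (forall u v, h u v = x *: f u v + g u v) ->
  tlift h X = x *: tlift f X + tlift g X.
Proof.
move=> hE; rewrite /tlift scaler_sumr -big_split; apply: eq_bigr => i _ /=.
rewrite scaler_sumr -big_split; apply: eq_bigr => j _ /=.
by rewrite hE scalerDr !scalerA mulrC.
Qed.

Lemma tensor_sum (X : tensor U V) :
  X = \sum_i \sum_j X i j *: (bvec i \ot bvec j).
Proof.
rewrite [LHS]matrix_sum_delta; apply: eq_bigr => i _; apply: eq_bigr => j _.
congr (_ *: _); rewrite /ptens !r2vK.
by apply/matrixP=> i' j'; rewrite !mxE big_ord1 !mxE eqxx /= -natrM mulnb.
Qed.

Lemma tensor_ind (P : tensor U V -> Prop) :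
  (forall a X Y, P X -> P Y -> P (a *: X + Y)) ->
  (forall u v, P (u \ot v)) -> forall X, P X.
Proof.
move=> PD Pt X; have P0 : P 0.
  by have := PD (-1) _ _ (Pt 0 0) (Pt 0 0); rewrite scaleN1r addNr.
rewrite (tensor_sum X); elim/big_rec: _ => // i Y _ PY.
elim/big_rec: _ => [|j Z _ PZ]; first by rewrite add0r.
by rewrite -addrA; apply: PD.
Qed.

End TensorTheory.

Section TensorAlgebra.
Variables (F : fieldType) (A B : falgType F).
Local Notation T := (tensor A B).

Definition tensor1 : T := (1 : A) \ot (1 : B).
Definition tensor_mul (X Y : T) : T :=
  tlift (fun a b => tlift (fun c d => (a * c) \ot (b * d)) Y) X.

Fact tensor_mul_bilin_in (a : A) (b : B) :
  bilin (fun c d => (a * c) \ot (b * d)).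
Proof.
have [l r] := @ptens_bilin F A B.
by split=> [d x c c'|c x d d'] /=; rewrite mulrDr -scalerAr (l, r).
Qed.

Fact tensor_mul_bilin_out (Y : T) :
  bilin (fun (a : A) (b : B) => tlift (fun c d => (a * c) \ot (b * d)) Y).
Proof.
have [l r] := @ptens_bilin F A B.
by split=> [b x a a'|a x b b'] /=; apply: tlift_linear_fun => c d;
  rewrite mulrDl -scalerAl (l, r).
Qed.

Lemma tensor_mulE a b c d :
  tensor_mul (a \ot b) (c \ot d) = (a * c) \ot (b * d).
Proof.
rewrite /tensor_mul tliftE; last exact: tensor_mul_bilin_out.
by rewrite tliftE //; apply: tensor_mul_bilin_in.
Qed.

Fact tensor_mul_linl Y : linear (tensor_mul^~ Y).
Proof. exact: tlift_linear. Qed.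

Fact tensor_mul_linr X : linear (tensor_mul X).
Proof.
by move=> x Y Y'; apply: tlift_linear_fun => a b; apply: tlift_linear.
Qed.

Fact tensor_mulA : associative tensor_mul.
Proof.
move=> X Y Z; elim/tensor_ind: X => [x X X' IH IH'|a b].
  by rewrite !tensor_mul_linl IH IH'.
elim/tensor_ind: Y => [x Y Y' IH IH'|c d].
  by rewrite !(tensor_mul_linl, tensor_mul_linr) IH IH'.
elim/tensor_ind: Z => [x Z Z' IH IH'|e f].
  by rewrite !tensor_mul_linr IH IH'.
by rewrite !tensor_mulE !mulrA.
Qed.

Fact tensor_mul1l : left_id tensor1 tensor_mul.
Proof.
elim/tensor_ind => [x Y Y' IH IH'|c d]; first by rewrite tensor_mul_linr IH IH'.
by rewrite tensor_mulE !mul1r.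
Qed.

Fact tensor_mul1r : right_id tensor1 tensor_mul.
Proof.
elim/tensor_ind => [x Y Y' IH IH'|c d]; first by rewrite tensor_mul_linl IH IH'.
by rewrite tensor_mulE !mulr1.
Qed.

Fact tensor_mulDl : left_distributive tensor_mul +%R.
Proof. by move=> X Y Z; have := tensor_mul_linl Z 1 X Y; rewrite !scale1r. Qed.

Fact tensor_mulDr : right_distributive tensor_mul +%R.
Proof. by move=> X Y Z; have := tensor_mul_linr X 1 Y Z; rewrite !scale1r. Qed.

Fact tensor1_neq0 : tensor1 != 0.
Proof.
have /rV0Pn[i Ai] : v2r (1 : A) != 0.
  by apply: contra_neq (oner_neq0 A) => /(canRL (@v2rK _ A)); rewrite linear0.
have /rV0Pn[j Bj] : v2r (1 : B) != 0.
  by apply: contra_neq (oner_neq0 B) => /(canRL (@v2rK _ B)); rewrite linear0.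
apply: contraNneq (mulf_neq0 Ai Bj) => /matrixP/(_ i j).
by rewrite !mxE big_ord1 !mxE => ->.
Qed.

HB.instance Definition _ := GRing.Zmodule_isNzRing.Build (tensor A B)
  tensor_mulA tensor_mul1l tensor_mul1r tensor_mulDl tensor_mulDr tensor1_neq0.

Fact tensor_scaleAl (x : F) (X Y : T) : x *: (X * Y) = x *: X * Y.
Proof.
have := tensor_mul_linl Y x X 0; rewrite -[tensor_mul 0 Y]/(0 * Y).
by rewrite mul0r !addr0.
Qed.

HB.instance Definition _ :=
  GRing.Lmodule_isLalgebra.Build F (tensor A B) tensor_scaleAl.

Fact tensor_scaleAr (x : F) (X Y : T) : x *: (X * Y) = X * (x *: Y).
Proof.
have := tensor_mul_linr X x Y 0; rewrite -[tensor_mul X 0]/(X * 0).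
by rewrite mulr0 !addr0.
Qed.

HB.instance Definition _ :=
  GRing.Lalgebra_isAlgebra.Build F (tensor A B) tensor_scaleAr.

HB.instance Definition _ := Algebra_isFalgebra.Build F (tensor A B).

Lemma ptensM (a c : A) (b d : B) :
  (a \ot b) * (c \ot d) = (a * c) \ot (b * d).
Proof. exact: tensor_mulE. Qed.

End TensorAlgebra.

Section Hopf.
Variable F : fieldType.

Definition tmap (U V U' V' : vectType F) (f : U -> U') (g : V -> V') :
  tensor U V -> tensor U' V' := tlift (fun u v => f u \ot g v).

Definition tflip (U V : vectType F) : tensor U V -> tensor V U :=
  tlift (fun u v => v \ot u).

Definition tassoc (U V W : vectType F) :
    tensor (tensor U V) W -> tensor U (tensor V W) :=
  tlift (fun X w => tlift (fun u v => u \ot (v \ot w)) X).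

Record hopf_data (H : falgType F) := HopfData {
  comul : H -> tensor H H;
  counit : H -> F;
  antipode : H -> H
}.

Record is_hopf (H : falgType F) (D : hopf_data H) : Prop := IsHopf {
  comul_linear : linear (comul D);
  comul_mul : {morph comul D : x y / x * y};
  comul_one : comul D 1 = 1;
  counit_linear : scalar (counit D);
  counit_mul : {morph counit D : x y / x * y};
  counit_one : counit D 1 = 1;
  antipode_linear : linear (antipode D);
  comul_assoc : forall x,
    tassoc (tmap (comul D) id (comul D x)) = tmap id (comul D) (comul D x);
  counit_l : forall x, tlift (fun a b => counit D a *: b) (comul D x) = x;
  counit_r : forall x, tlift (fun a b => counit D b *: a) (comul D x) = x;
  antipode_l : forall x,
    tlift (fun a b => antipode D a * b) (comul D x) = (counit D x)%:A;
  antipode_r : forall x,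
    tlift (fun a b => a * antipode D b) (comul D x) = (counit D x)%:A
}.

Definition leg12 (H : falgType F) (X : tensor H H) : tensor H (tensor H H) :=
  tlift (fun a b => a \ot (b \ot (1 : H))) X.
Definition leg13 (H : falgType F) (X : tensor H H) : tensor H (tensor H H) :=
  tlift (fun a b => a \ot ((1 : H) \ot b)) X.
Definition leg23 (H : falgType F) (X : tensor H H) : tensor H (tensor H H) :=
  (1 : H) \ot X.

Record is_triangular (H : falgType F) (D : hopf_data H) (R : tensor H H) :
    Prop := IsTriangular {
  triangular_hopf : is_hopf D;
  triangular_unit : R \is a GRing.unit;
  triangular_comul_l : tassoc (tmap (comul D) id R) = leg13 R * leg23 R;
  triangular_comul_r : tmap id (comul D) R = leg13 R * leg12 R;
  triangular_op : forall x, tflip (comul D x) = R * comul D x * R^-1;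
  triangular_inv : tflip R = R^-1
}.

(* u = \sum S(R^(2)) R^(1) *)
Definition drinfeld (H : falgType F) (D : hopf_data H) (R : tensor H H) : H :=
  tlift (fun a b => antipode D b * a) R.

Definition Ru (H : falgType F) (D : hopf_data H) (R : tensor H H) :
    tensor H H :=
  let u := drinfeld D R in
  2^-1 *: ((1 : H) \ot (1 : H) + (1 : H) \ot u + u \ot (1 : H) - u \ot u).

Definition Rtilde (H : falgType F) (D : hopf_data H) (R : tensor H H) :
  tensor H H := R * Ru D R.

Record is_twist (H : falgType F) (D : hopf_data H) (J : tensor H H) : Prop :=
    IsTwist {
  twist_unit : J \is a GRing.unit;
  twist_cocycle :
    tassoc (tmap (comul D) id J) * leg12 J = tmap id (comul D) J * leg23 J;
  twist_counit_l : tlift (fun a b => counit D a *: b) J = 1;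
  twist_counit_r : tlift (fun a b => counit D b *: a) J = 1
}.

(* H^J: the algebra H with comultiplication J^-1 Delta(x) J; its antipode is
   conjugate to that of H by Q = sum S(J^(1)) J^(2). *)
Definition twist (H : falgType F) (D : hopf_data H) (J : tensor H H) :
    hopf_data H :=
  let Q := tlift (fun a b => antipode D a * b) J in
  HopfData (fun x => J^-1 * comul D x * J) (counit D)
    (fun x => Q^-1 * antipode D x * Q).

(* J_21^-1 J *)
Definition twistR (H : falgType F) (J : tensor H H) : tensor H H :=
  (tflip J)^-1 * J.

Definition tensorv (U V : vectType F) (B : {vspace U}) (C : {vspace V}) :
    {vspace (tensor U V)} :=
  span [seq b \ot c | b <- vbasis B, c <- vbasis C].

Record hopf_subalgebra (H : falgType F) (D : hopf_data H) (B : {vspace H}) :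
    Prop := HopfSubalgebra {
  hopf_sub_one : 1 \in B;
  hopf_sub_mul : {in B &, forall x y, x * y \in B};
  hopf_sub_comul : {in B, forall x, comul D x \in tensorv B B};
  hopf_sub_antipode : {in B, forall x, antipode D x \in B}
}.

(* Minimality in the sense of Radford: no proper Hopf subalgebra carries R. *)
Definition minimal_triangular (H : falgType F) (D : hopf_data H)
    (R : tensor H H) : Prop :=
  is_triangular D R /\
  forall B : {vspace H},
    hopf_subalgebra D B -> R \in tensorv B B -> B = fullv.

Definition minimal_twist (H : falgType F) (D : hopf_data H) (J : tensor H H) :
    Prop :=
  is_twist D J /\ minimal_triangular (twist D J) (twistR J).

Record is_hopf_iso (H1 H2 : falgType F) (D1 : hopf_data H1) (D2 : hopf_data H2)
    (phi : {lrmorphism H1 -> H2}) : Prop := IsHopfIso {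
  hopf_iso_bij : bijective phi;
  hopf_iso_comul : forall x, comul D2 (phi x) = tmap phi phi (comul D1 x);
  hopf_iso_counit : forall x, counit D2 (phi x) = counit D1 x;
  hopf_iso_antipode : forall x, antipode D2 (phi x) = phi (antipode D1 x)
}.

Definition triangular_isomorphic (H1 H2 : falgType F)
    (D1 : hopf_data H1) (R1 : tensor H1 H1)
    (D2 : hopf_data H2) (R2 : tensor H2 H2) : Prop :=
  [/\ is_triangular D1 R1, is_triangular D2 R2 &
    exists2 phi : {lrmorphism H1 -> H2},
      is_hopf_iso D1 D2 phi & tmap phi phi R1 = R2].

End Hopf.

Definition grpalg (F : fieldType) (gT : finGroupType) : Type :=
  {ffun gT -> F^o}.

HB.instance Definition _ (F : fieldType) (gT : finGroupType) :=
  Vector.copy (grpalg F gT) {ffun gT -> F^o}.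

Section GroupAlgebra.
Variables (F : fieldType) (gT : finGroupType).
Local Notation T := (grpalg F gT).

Definition gbase (a : gT) : T := [ffun b => (b == a)%:R].

Definition gmul (x y : T) : T := [ffun a => \sum_b x b * y (b^-1 * a)%g].

Fact gmulA : associative gmul.
Proof.
move=> x y z; apply/ffunP=> a; rewrite !ffunE.
under eq_bigr => b _ do rewrite ffunE mulr_sumr.
under [RHS]eq_bigr => b _ do rewrite ffunE mulr_suml.
rewrite [RHS]exchange_big; apply: eq_bigr => b _ /=.
rewrite [RHS](reindex_inj (mulgI b)); apply: eq_bigr => c _ /=.
by rewrite mulKg invMg mulgA mulrA.
Qed.

Fact gmul1l : left_id (gbase 1%g) gmul.
Proof.
move=> x; apply/ffunP=> a; rewrite ffunE (bigD1 1%g) //= ffunE eqxx mul1r.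
by rewrite invg1 mul1g big1 ?addr0 // => b /negbTE nb; rewrite ffunE nb mul0r.
Qed.

Fact gmul1r : right_id (gbase 1%g) gmul.
Proof.
move=> x; apply/ffunP=> a; rewrite ffunE (bigD1 a) //= ffunE mulVg eqxx mulr1.
rewrite big1 ?addr0 // => b /negbTE nb.
by rewrite ffunE -eq_mulVg1 nb mulr0.
Qed.

Fact gmulDl : left_distributive gmul +%R.
Proof.
move=> x y z; apply/ffunP=> a; rewrite !ffunE -big_split /=.
by apply: eq_bigr => b _; rewrite ffunE mulrDl.
Qed.

Fact gmulDr : right_distributive gmul +%R.
Proof.
move=> x y z; apply/ffunP=> a; rewrite !ffunE -big_split /=.
by apply: eq_bigr => b _; rewrite ffunE mulrDr.
Qed.

Fact gone_neq0 : gbase 1%g != 0.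
Proof. by apply/eqP => /ffunP/(_ 1%g)/eqP; rewrite !ffunE eqxx oner_eq0. Qed.

HB.instance Definition _ := GRing.Zmodule_isNzRing.Build (grpalg F gT)
  gmulA gmul1l gmul1r gmulDl gmulDr gone_neq0.

Fact gscaleAl (c : F) (x y : T) : c *: (x * y) = c *: x * y.
Proof.
apply/ffunP=> a; rewrite !ffunE scaler_sumr; apply: eq_bigr => b _.
by rewrite ffunE [LHS]mulrA.
Qed.

HB.instance Definition _ :=
  GRing.Lmodule_isLalgebra.Build F (grpalg F gT) gscaleAl.

Fact gscaleAr (c : F) (x y : T) : c *: (x * y) = x * (c *: y).
Proof.
apply/ffunP=> a; rewrite !ffunE scaler_sumr; apply: eq_bigr => b _.
by rewrite ffunE [LHS]mulrCA.
Qed.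

HB.instance Definition _ :=
  GRing.Lalgebra_isAlgebra.Build F (grpalg F gT) gscaleAr.

HB.instance Definition _ := Algebra_isFalgebra.Build F (grpalg F gT).

Definition grp_hopf : hopf_data (grpalg F gT) :=
  HopfData (fun x : T => \sum_a x a *: (gbase a \ot gbase a))
    (fun x : T => \sum_a x a)
    (fun x : T => \sum_a x a *: gbase a^-1%g).

End GroupAlgebra.

Arguments gbase {F gT} a.

Definition grpalg_incl (F : fieldType) (L : finGroupType) (K : {group L})
    (x : grpalg F (subg_of K)) : grpalg F L :=
  \sum_a x a *: gbase (sgval a).

(* (L, K, J) is the Etingof-Gelaki data associated with (H, R): J is a minimal
   twist for k[K] and (H, R R_u) is isomorphic to the twist of (k[L], 1 \ot 1)
   by the image of J in k[L] \ot k[L]. *)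
Definition etingof_gelaki_data (F : fieldType) (H : falgType F)
    (D : hopf_data H) (R : tensor H H) (L : finGroupType) (K : {group L})
    (J : tensor (grpalg F (subg_of K)) (grpalg F (subg_of K))) : Prop :=
  let JL := tmap (@grpalg_incl F L K) (@grpalg_incl F L K) J in
  minimal_twist (grp_hopf F (subg_of K)) J /\
  triangular_isomorphic D (Rtilde D R)
    (twist (grp_hopf F L) JL) (twistR JL).

Arguments etingof_gelaki_data {F H} D R L K J.

Section CharacterGroup.
Variables (k : closedFieldType) (G : finGroupType).

(* Hom(G, k^x); a character is given by its k-valued function. *)
Definition is_khom (f : {ffun G -> k}) : bool :=
  [forall x, f x != 0] && [forall x, forall y, f (x * y)%g == f x * f y].

Record khom := KHom { khom_fun : {ffun G -> k}; _ : is_khom khom_fun }.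

Definition khom_app (a : khom) : G -> k := khom_fun a.
Coercion khom_app : khom >-> Funclass.

HB.instance Definition _ := [isSub for khom_fun].
HB.instance Definition _ := [Choice of khom by <:].

Lemma khomP (a b : khom) : (forall x, a x = b x) <-> a = b.
Proof. by split=> [eqab|->//]; apply/val_inj/ffunP. Qed.

Lemma khom_neq0 (a : khom) x : a x != 0.
Proof. by have /andP[/forallP/(_ x)] := valP a. Qed.

Lemma khomM (a : khom) x y : a (x * y)%g = a x * a y.
Proof. by have /andP[_ /forallP/(_ x)/forallP/(_ y)/eqP] := valP a. Qed.

Lemma khom1 (a : khom) : a 1%g = 1.
Proof. by apply: (mulfI (khom_neq0 a 1%g)); rewrite -khomM !mulg1 mulr1. Qed.

Lemma khomX (a : khom) x n : a (x ^+ n)%g = a x ^+ n.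
Proof.
by elim: n => [|n IH]; rewrite ?expg0 ?khom1 // expgS exprS khomM IH.
Qed.

Lemma khomV (a : khom) x : a x^-1%g = (a x)^-1.
Proof.
by apply: (mulfI (khom_neq0 a x)); rewrite -khomM mulgV khom1 divff ?khom_neq0.
Qed.

(* Finiteness: the values of a character are roots of X^#|G| - 1. *)
Definition khom_roots : seq k :=
  sval (closed_field_poly_normal ('X^#|G| - 1 : {poly k})).

Fact khom_in_roots (a : khom) x : a x \in khom_roots.
Proof.
have := svalP (closed_field_poly_normal ('X^#|G| - 1 : {poly k})).
rewrite -/khom_roots => E; rewrite -root_prod_XsubC.
have G0 : (0 < #|G|)%N by apply/card_gt0P; exists 1%g.
have lc : lead_coef ('X^#|G| - 1 : {poly k}) != 0.
  by rewrite lead_coef_eq0 -size_poly_gt0 size_XnsubC.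
rewrite -(rootZ _ _ lc) -E rootE !hornerE -khomX.
by rewrite -cardsT (expg_cardG (in_setT x)) khom1 subrr.
Qed.

Definition khom_code (a : khom) : {ffun G -> seq_sub khom_roots} :=
  [ffun x => SeqSub (khom_in_roots a x)].

Definition khom_decode (c : {ffun G -> seq_sub khom_roots}) : option khom :=
  insub [ffun x => val (c x)].

Fact khom_codeK : pcancel khom_code khom_decode.
Proof.
move=> a; rewrite /khom_decode; set f := [ffun x => _].
have -> : f = val a by apply/ffunP=> x; rewrite !ffunE.
by rewrite valK.
Qed.

HB.instance Definition _ := PCanIsCountable khom_codeK.
HB.instance Definition _ : isFinite khom := PCanIsFinite khom_codeK.

Fact khom_one_proof : is_khom [ffun=> 1].
Proof.
apply/andP; split; first by apply/forallP=> x; rewrite ffunE oner_eq0.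
by apply/forallP=> x; apply/forallP=> y; rewrite !ffunE mulr1.
Qed.

Fact khom_mul_proof (a b : khom) : is_khom [ffun x => a x * b x].
Proof.
apply/andP; split.
  by apply/forallP=> x; rewrite ffunE mulf_neq0 ?khom_neq0.
by apply/forallP=> x; apply/forallP=> y; rewrite !ffunE !khomM mulrACA.
Qed.

Fact khom_inv_proof (a : khom) : is_khom [ffun x => (a x)^-1].
Proof.
apply/andP; split; first by apply/forallP=> x; rewrite ffunE invr_eq0 khom_neq0.
by apply/forallP=> x; apply/forallP=> y; rewrite !ffunE khomM invfM.
Qed.

Definition khom_one : khom := KHom khom_one_proof.
Definition khom_mul (a b : khom) : khom := KHom (khom_mul_proof a b).
Definition khom_inv (a : khom) : khom := KHom (khom_inv_proof a).

Fact khom_oneE_def x : khom_one x = 1. Proof. exact: ffunE. Qed.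
Fact khom_mulE_def a b x : khom_mul a b x = a x * b x. Proof. exact: ffunE. Qed.
Fact khom_invE_def a x : khom_inv a x = (a x)^-1. Proof. exact: ffunE. Qed.

Fact khom_mulA : associative khom_mul.
Proof. by move=> a b c; apply/khomP=> x; rewrite !khom_mulE_def mulrA. Qed.

Fact khom_mul1 : left_id khom_one khom_mul.
Proof.
by move=> a; apply/khomP=> x; rewrite khom_mulE_def khom_oneE_def mul1r.
Qed.

Fact khom_mulV : left_inverse khom_one khom_inv khom_mul.
Proof.
move=> a; apply/khomP=> x.
by rewrite khom_mulE_def khom_invE_def khom_oneE_def mulVf ?khom_neq0.
Qed.

HB.instance Definition _ :=
  Finite_isGroup.Build khom khom_mulA khom_mul1 khom_mulV.

Lemma khom_mulE (a b : khom) x : (a * b)%g x = a x * b x.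
Proof. exact: ffunE. Qed.

Lemma khom_oneE x : (1%g : khom) x = 1.
Proof. exact: ffunE. Qed.

End CharacterGroup.

(* [commfactor_skew] makes the values nonzero, i.e. in k^x. *)
Record commfactor (k : fieldType) (G : finGroupType) := CommFactor {
  commfactor_fun :> G -> G -> k;
  commfactor_mull : forall g h l,
    commfactor_fun (g * h)%g l = commfactor_fun g l * commfactor_fun h l;
  commfactor_mulr : forall g h l,
    commfactor_fun g (h * l)%g = commfactor_fun g h * commfactor_fun g l;
  commfactor_skew : forall g h,
    commfactor_fun g h * commfactor_fun h g = 1
}.

Lemma commfactor_neq0 (k : fieldType) (G : finGroupType)
    (beta : commfactor k G) g h : beta g h != 0.
Proof.
apply/eqP=> b0; have := commfactor_skew beta g h.
by rewrite b0 mul0r => /esym/eqP; rewrite oner_eq0.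
Qed.

Definition normalized_2cocycle (k : fieldType) (G : finGroupType)
    (c : G -> G -> k) : Prop :=
  [/\ forall g h, c g h != 0,
      forall g h l, c g h * c (g * h)%g l = c h l * c g (h * l)%g &
      forall g, c 1%g g = 1 /\ c g 1%g = 1].

Section Data.
Variables (k : closedFieldType) (G : finGroupType) (beta : commfactor k G).
Local Notation A := (khom k G).
Local Notation kA := (grpalg k (khom k G)).

Definition vvec (g : G) : kA :=
  #|G|%:R^-1 *: \sum_(a : A) a g^-1%g *: gbase a.

Definition Rbeta : tensor kA kA :=
  \sum_g \sum_h beta g h *: (vvec g \ot vvec h).

(* The Drinfeld element of (k[A], Rbeta) is \sum_g ufun g *: vvec g. *)
Definition ufun (g : G) : k := beta g g.

Definition kappa (g h : G) : k :=
  if (ufun g == -1) && (ufun h == -1) then -1 else 1.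

Lemma ufun_pm1 g : ufun g = 1 \/ ufun g = -1.
Proof.
have /eqP := commfactor_skew beta g g.
by rewrite -expr2 sqrf_eq1 => /orP[]/eqP; [left|right].
Qed.

Lemma ufunM g h : ufun (g * h)%g = ufun g * ufun h.
Proof.
rewrite /ufun commfactor_mull !commfactor_mulr [beta h g * _]mulrC mulrACA.
by rewrite commfactor_skew mulr1.
Qed.

Fact kappaM g h l : kappa (g * h)%g l = kappa g l * kappa h l.
Proof.
rewrite /kappa ufunM.
have [e1|n1] := eqVneq (1 : k) (-1); first by rewrite -e1 !if_same mulr1.
case: (ufun_pm1 g) (ufun_pm1 h) (ufun_pm1 l) => -> [] -> [] ->;
  rewrite ?(mulr1, mul1r, mulrNN, eqxx, negbTE n1) ?(mulr1, mul1r) //=;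
  by rewrite ?(mulr1, mul1r, mulrNN, eqxx, negbTE n1).
Qed.

Fact kappaC g h : kappa g h = kappa h g.
Proof. by rewrite /kappa andbC. Qed.

Fact kappa_sqr g h : kappa g h * kappa g h = 1.
Proof. by rewrite /kappa; case: ifP; rewrite ?mulrNN mulr1. Qed.

Definition betakappa_fun (g h : G) : k := beta g h * kappa g h.

Fact betakappa_mull g h l :
  betakappa_fun (g * h)%g l = betakappa_fun g l * betakappa_fun h l.
Proof. by rewrite /betakappa_fun commfactor_mull kappaM mulrACA. Qed.

Fact betakappa_mulr g h l :
  betakappa_fun g (h * l)%g = betakappa_fun g h * betakappa_fun g l.
Proof.
by rewrite /betakappa_fun commfactor_mulr !(kappaC g) kappaM mulrACA.
Qed.

Fact betakappa_skew g h : betakappa_fun g h * betakappa_fun h g = 1.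
Proof.
by rewrite /betakappa_fun mulrACA commfactor_skew (kappaC h) kappa_sqr mulr1.
Qed.

Definition betakappa : commfactor k G :=
  CommFactor betakappa_mull betakappa_mulr betakappa_skew.

Fact chi_proof g : is_khom [ffun h => betakappa g h].
Proof.
apply/andP; split.
  by apply/forallP=> h; rewrite ffunE (commfactor_neq0 betakappa).
apply/forallP=> h; apply/forallP=> l.
by rewrite !ffunE (commfactor_mulr betakappa).
Qed.

Definition chi (g : G) : A := KHom (chi_proof g).

Lemma chiE g h : chi g h = betakappa g h.
Proof. exact: ffunE. Qed.

Fact chiM : {in [set: G] &, {morph chi : g h / (g * h)%g}}.
Proof.
move=> g h _ _; apply/khomP=> l.
by rewrite khom_mulE !chiE (commfactor_mull betakappa).
Qed.

Canonical chi_morphism := Morphism chiM.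

Definition kerchi : {group G} := ('ker chi)%G.

Definition Kset : {set A} := [set a : A | [forall g in kerchi, a g == 1]].

Fact Kset_group : group_set Kset.
Proof.
apply/group_setP; split=> [|a b].
  by rewrite inE; apply/forall_inP=> g _; rewrite khom_oneE.
rewrite !inE => /forall_inP a1 /forall_inP b1; apply/forall_inP=> g kg.
by rewrite khom_mulE (eqP (a1 g kg)) (eqP (b1 g kg)) mulr1.
Qed.

Canonical K : {group A} := Group Kset_group.

(* Since kerchi is normal in G, this type is the full quotient G / kerchi. *)
Definition quoG : finGroupType := coset_of kerchi.

Definition betaquo (x y : quoG) : k := betakappa (repr x) (repr y).

(* The value at x in G / kerchi of the character of G / kerchi given by a. *)
Definition Kapp (a : subg_of K) (x : quoG) : k := sgval a (repr x).

Lemma ker_chi_norm g : g \in ('N(kerchi))%g.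
Proof.
by have /subsetP/(_ g (in_setT g)) := normal_norm (ker_normal chi_morphism).
Qed.

Lemma repr_coset_ker g :
  exists2 l, l \in kerchi & repr (coset kerchi g) = (l * g)%g.
Proof.
have := mem_repr_coset (coset kerchi g).
by rewrite val_coset ?ker_chi_norm // => /rcosetP[l kl ->]; exists l.
Qed.

Lemma ker_chiE l g : l \in kerchi -> betakappa l g = 1 /\ betakappa g l = 1.
Proof.
move=> /mker e; have e1: betakappa l g = 1 by rewrite -chiE e khom_oneE.
by split=> //; have := betakappa_skew g l; rewrite [betakappa_fun l g]e1 mulr1.
Qed.

Lemma betaquoE g h :
  betaquo (coset kerchi g) (coset kerchi h) = beta g h * kappa g h.
Proof.
rewrite /betaquo; have [l kl ->] := repr_coset_ker g.
have [m km ->] := repr_coset_ker h.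
rewrite (commfactor_mull betakappa) (proj1 (ker_chiE _ kl)) mul1r.
by rewrite (commfactor_mulr betakappa) (proj2 (ker_chiE _ km)) mul1r.
Qed.

Lemma KappE (a : subg_of K) g : Kapp a (coset kerchi g) = sgval a g.
Proof.
rewrite /Kapp; have [l kl ->] := repr_coset_ker g; rewrite khomM.
by have := subgP a; rewrite inE => /forall_inP/(_ l kl)/eqP ->; rewrite mul1r.
Qed.

Definition vquo (x : quoG) : grpalg k (subg_of K) :=
  #|quoG|%:R^-1 *: \sum_(a : subg_of K) Kapp a x^-1%g *: gbase a.

Definition Jquo (gamma : quoG -> quoG -> k) :
    tensor (grpalg k (subg_of K)) (grpalg k (subg_of K)) :=
  \sum_x \sum_y gamma x y *: (vquo x \ot vquo y).

End Data.

(* Main.v *)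
Require Import Defs.
From HB Require Import structures.
From mathcomp Require Import all_boot all_order all_algebra all_fingroup all_solvable all_field.
From mathcomp Require Import mxrepresentation.
Import GRing.Theory VectorInternalTheory.
Local Open Scope ring_scope.

Set Implicit Arguments.
Unset Strict Implicit.
Unset Printing Implicit Defensive.

(* By Fourier inversion the vectors v_g are orthogonal idempotents identifying
   k[A] with the function algebra k^G, and those of G' = G / ker chi identify
   k[K] with k^G'. Tensors then become functions of several group variables,
   multiplied pointwise, and the Hopf, twist and triangularity axioms become the
   cocycle and bicharacter identities. Since k^G is commutative, twisting by J
   does not change the Hopf structure, so the identity map is the required
   isomorphism: both R-matrices are given by the function beta * kappa.
   Minimality is orthogonality of the non-degenerate bicharacter beta'. *)

(** * Characters separate the points of a finite abelian group *)

(** The minimal polynomial of [A] divides X^m - 1, which splits over [k] and is separable because m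
    is nonzero in [k]. *)
Lemma diagonalizable_finite_order (k : closedFieldType) (n m : nat)
    (A : 'M[k]_n) : m%:R != 0 :> k -> A ^+ m = 1 -> diagonalizable A.
Proof.
(* The 0 x 0 matrices are set apart, since they form the zero ring. *)
case: n => [|n] in A * => m0 Am.
  exists 1%:M; first exact: unitmx1.
  by apply/diag_mxP; exists 0; apply/matrixP=> -[].
have [r Xr] := closed_field_poly_normal ('X^m - 1 : {poly k}).
have lc : lead_coef ('X^m - 1 : {poly k}) != 0.
  rewrite lead_coef_eq0 -size_poly_gt0 size_XnsubC // lt0n.
  by apply: contraNneq m0 => ->.
apply/diagonalizableP; exists r.
  rewrite -separable_prod_XsubC -(eqp_separable (eqp_scale _ lc)) -Xr.
  exact: cyclotomic.separable_Xn_sub_1.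
rewrite -(eqp_dvdr _ (eqp_scale _ lc)) -Xr; apply: mxminpoly_min.
by rewrite rmorphB rmorph1 /= rmorphXn /= horner_mx_X Am subrr.
Qed.

Lemma natf_neq0_char0 (k : fieldType) (n : nat) :
  [pchar k] =i pred0 -> (0 < n)%N -> n%:R != 0 :> k.
Proof. by move=> /pcharf0P -> /lt0n_neq0. Qed.

(* The diagonal entries of the simultaneously diagonalized regular
   representation are characters, and this representation is faithful. *)
Lemma khom_separates (k : closedFieldType) (G : finGroupType) (x : G) :
  [pchar k] =i pred0 -> abelian [set: G] -> x != 1%g ->
  exists a : khom k G, a x != 1.
Proof.
move=> char0 abG x1; pose rho := regular_repr k [set: G].
have rhoM g h : rho (g * h)%g = rho g *m rho h by rewrite repr_mxM ?inE.
have rhoX g n : rho (g ^+ n)%g = rho g ^+ n.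
  elim: n => [|n IH]; first by rewrite expg0 repr_mx1.
  by rewrite expgS exprS rhoM IH.
(* Commuting diagonalizable matrices have a common diagonalizing basis [P]. *)
have [P uP /allP/= diagP] : codiagonalizable [seq rho g | g <- enum G].
  apply/codiagonalizableP.
  split=> [_ _ /mapP[g _ ->] /mapP[h _ ->]|_ /mapP[g _ ->]].
    by rewrite /comm_mx -!rhoM (centsP abG) ?inE.
  apply: (@diagonalizable_finite_order _ _ #|[set: G]|).
    by rewrite natf_neq0_char0 ?cardG_gt0.
  by rewrite -rhoX expg_cardG ?inE // repr_mx1.
pose D g := conjmx P (rho g).
have Ddiag g i j : i != j -> D g i j = 0.
  have := diagP (rho g) (map_f _ _); rewrite mem_enum inE => /(_ isT).
  by move=> /is_diag_mxP; apply.
have DM g h i : D (g * h)%g i i = D g i i * D h i i.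
  have -> : D (g * h)%g = D g *m D h.
    by rewrite /D !conjumx // rhoM !mulmxA mulmxKV.
  rewrite mxE (bigD1 i) //= big1 ?addr0 // => j ij.
  by rewrite Ddiag ?mul0r // eq_sym.
have D1 i : D 1%g i i = 1.
  by rewrite /D conjumx // repr_mx1 mulmx1 mulmxV // mxE eqxx.
have charP i : is_khom [ffun g => D g i i].
  apply/andP; split; apply/forallP=> g; rewrite ?ffunE.
    apply: contra_neq (oner_neq0 k) => g0.
    by rewrite -(D1 i) -(mulgV g) DM g0 mul0r.
  by apply/forallP=> h; rewrite !ffunE DM.
suff [i Dx] : exists i, D x i i != 1.
  by exists (KHom (charP i)); rewrite /khom_app /= ffunE.
(* If every diagonal character is 1 at [x], then [rho x] is the identity and faithfulness gives x =
   1. *)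
apply/existsP; apply: contraNT x1 => /existsPn Dx1; apply/eqP.
suff rx : rho x = 1%:M.
  apply/set1P; apply: (subsetP (regular_mx_faithful k [set: G])).
  by rewrite inE in_setT mul1mx rx eqxx.
rewrite -(conjmxK (rho x) uP) -/(D x).
have -> : D x = 1%:M.
  apply/matrixP=> i j; rewrite [RHS]mxE.
  have [<-|ij] := eqVneq i j; last exact: Ddiag.
  by have := Dx1 i; rewrite negbK => /eqP.
by rewrite conjVmx // mulmx1 mulVmx.
Qed.

(** * Bilinear maps and pure tensors *)

(** Serves the bilinearity conditions of [tlift_tlcomb] and [tlift_col], where the maps are mostly a
    bilinear map composed with linear ones. *)
Lemma bilin_comp (F : fieldType) (U V U' V' W W' : vectType F)
    (f : U' -> V' -> W) (l : W -> W') (p : U -> U') (q : V -> V') :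
  linear l -> linear p -> linear q -> bilin f ->
  bilin (fun u v => l (f (p u) (q v))).
Proof.
move=> l_lin p_lin q_lin [f1 f2].
by split=> [v a x y|u a x y] /=; rewrite (p_lin, q_lin) (f1, f2) l_lin.
Qed.

Lemma mul_bilin (F : fieldType) (H : falgType F) : bilin (@GRing.mul H).
Proof.
by split=> [v a x y|u a x y]; rewrite ?mulrDl ?mulrDr -?scalerAl -?scalerAr.
Qed.

Lemma scalar_bilin (F : fieldType) (U V : vectType F) (l : U -> F) :
  scalar l -> bilin (fun u (v : V) => l u *: v).
Proof.
move=> l_lin; split=> [v a x y|u a x y] /=.
  by rewrite l_lin scalerDl scalerA.
by rewrite scalerDr !scalerA mulrC.
Qed.

Lemma ptens0l (F : fieldType) (U V : vectType F) (w : V) : (0 : U) \ot w = 0.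
Proof. by rewrite /ptens linear0 trmx0 mul0mx. Qed.

Lemma ptensDr (F : fieldType) (U V : vectType F) (u : U) (w w' : V) :
  u \ot (w + w') = u \ot w + u \ot w'.
Proof. by rewrite /ptens linearD mulmxDr. Qed.

Lemma ptensZl (F : fieldType) (U V : vectType F) a (u : U) (w : V) :
  (a *: u) \ot w = a *: (u \ot w).
Proof. by rewrite /ptens !linearZ -scalemxAl. Qed.

Lemma ptensZr (F : fieldType) (U V : vectType F) (u : U) a (w : V) :
  u \ot (a *: w) = a *: (u \ot w).
Proof. by rewrite /ptens linearZ -scalemxAr. Qed.

Lemma ptens_suml (F : fieldType) (U V : vectType F) I r (x : I -> U) (w : V) :
  (\sum_(i <- r) x i) \ot w = \sum_(i <- r) x i \ot w.
Proof. by rewrite /ptens !linear_sum mulmx_suml. Qed.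

Lemma ptens_sumr (F : fieldType) (U V : vectType F) I r (u : U) (y : I -> V) :
  u \ot (\sum_(i <- r) y i) = \sum_(i <- r) u \ot y i.
Proof. by rewrite /ptens linear_sum mulmx_sumr. Qed.

(** Translation by [z] gives S = f(z) S for the sum S, and f(z) differs from 1 in a domain. *)
Lemma sum_multiplicative (X : finGroupType) (R : idomainType) (f : X -> R) z :
  {morph f : x y / (x * y)%g >-> x * y} -> f z != 1 -> \sum_x f x = 0.
Proof.
move=> fM fz; apply/eqP; have : \sum_x f x = f z * \sum_x f x.
  by rewrite {1}(reindex_inj (mulgI z)) mulr_sumr; under eq_bigr do rewrite fM.
move/eqP; rewrite -subr_eq0 -{1}[\sum_x _]mul1r -mulrBl mulf_eq0 subr_eq0.
by rewrite eq_sym (negbTE fz).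
Qed.

(** * The function algebra of a finite group in its basis of idempotents *)

Section FunctionAlgebra.
Variables (F : fieldType) (H : falgType F) (G : finGroupType) (v : G -> H).

Definition lcomb (f : G -> F) : H := \sum_g f g *: v g.

(** A function on G x G seen as a tensor, expanded one factor at a time so that [colM] multiplies
    twofold and threefold tensors alike. *)
Definition tlcomb (f : G -> G -> F) : tensor H H :=
  \sum_g v g \ot lcomb (f g).

(* (H, D) is k^G, with v g the delta function and ev g the evaluation at g. *)
Record function_algebra (D : hopf_data H) (ev : G -> H -> F) : Prop :=
    FunctionAlgebra {
  ev_linear : forall g, scalar (ev g);
  ev_mul : forall g, {morph ev g : x y / x * y};
  ev_one : forall g, ev g 1 = 1;
  ev_idem : forall g h, ev g (v h) = (h == g)%:R;
  lcomb_ev : forall x, lcomb (ev^~ x) = x;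
  fa_comul : forall x, comul D x = tlcomb (fun g h => ev (g * h)%g x);
  fa_counit : forall x, counit D x = ev 1%g x;
  fa_antipode : forall x, antipode D x = lcomb (fun g => ev g^-1%g x)
}.

Lemma eq_lcomb f1 f2 : f1 =1 f2 -> lcomb f1 = lcomb f2.
Proof. by move=> E; apply: eq_bigr => g _; rewrite E. Qed.

Lemma eq_tlcomb f1 f2 : f1 =2 f2 -> tlcomb f1 = tlcomb f2.
Proof. by move=> E; apply: eq_bigr => g _; rewrite (eq_lcomb (E g)). Qed.

Lemma lcomb_delta (h : G) : lcomb (fun g => (h == g)%:R) = v h.
Proof.
rewrite /lcomb (bigD1 h) //= eqxx scale1r big1 ?addr0 // => g gh.
by rewrite eq_sym (negbTE gh) scale0r.
Qed.

Lemma lcombP a f1 f2 :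
  a *: lcomb f1 + lcomb f2 = lcomb (fun g => a * f1 g + f2 g).
Proof.
rewrite /lcomb scaler_sumr -big_split; apply: eq_bigr => g _ /=.
by rewrite scalerDl scalerA.
Qed.

Lemma sum_lcomb (I : Type) (r : seq I) (a : I -> F) (f : I -> G -> F) :
  \sum_(i <- r) a i *: lcomb (f i) = lcomb (fun g => \sum_(i <- r) a i * f i g).
Proof.
rewrite /lcomb; under eq_bigr => i _ do rewrite scaler_sumr.
rewrite exchange_big; apply: eq_bigr => g _ /=.
by rewrite scaler_suml; apply: eq_bigr => i _; rewrite scalerA.
Qed.

Lemma lcombZ a f : a *: lcomb f = lcomb (fun g => a * f g).
Proof.
by rewrite /lcomb scaler_sumr; apply: eq_bigr => g _; rewrite scalerA.
Qed.

Lemma tlcombD f1 f2 :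
  tlcomb f1 + tlcomb f2 = tlcomb (fun g h => f1 g h + f2 g h).
Proof.
rewrite /tlcomb -big_split; apply: eq_bigr => g _ /=.
rewrite -ptensDr -[lcomb (f1 g)]scale1r lcombP.
by under eq_lcomb do rewrite mul1r.
Qed.

Lemma tlcombZ a f : a *: tlcomb f = tlcomb (fun g h => a * f g h).
Proof.
rewrite /tlcomb scaler_sumr; apply: eq_bigr => g _.
by rewrite -ptensZr lcombZ.
Qed.

Lemma tlcombP a f1 f2 :
  a *: tlcomb f1 + tlcomb f2 = tlcomb (fun g h => a * f1 g h + f2 g h).
Proof. by rewrite tlcombZ tlcombD. Qed.

Lemma sum_tlcomb (I : Type) (r : seq I) (a : I -> F) (f : I -> G -> G -> F) :
  \sum_(i <- r) a i *: tlcomb (f i) =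
  tlcomb (fun g h => \sum_(i <- r) a i * f i g h).
Proof.
rewrite /tlcomb; under eq_bigr => i _ do rewrite scaler_sumr.
rewrite exchange_big; apply: eq_bigr => g _ /=.
by rewrite -sum_lcomb ptens_sumr; apply: eq_bigr => i _; rewrite ptensZr.
Qed.

Lemma tlcombE f : tlcomb f = \sum_g \sum_h f g h *: (v g \ot v h).
Proof.
apply: eq_bigr => g _; rewrite ptens_sumr.
by apply: eq_bigr => h _; rewrite ptensZr.
Qed.

Lemma tlift_tlcomb (W : vectType F) (f : H -> H -> W) b : bilin f ->
  tlift f (tlcomb b) = \sum_g \sum_h b g h *: f (v g) (v h).
Proof.
move=> bf; rewrite tlcombE linear_sum; apply: eq_bigr => g _.
rewrite linear_sum; apply: eq_bigr => h _.
by rewrite linearZ /= tliftE.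
Qed.

Lemma tlift_col (U W : vectType F) (f : H -> U -> W) (X : G -> U) : bilin f ->
  tlift f (\sum_g v g \ot X g) = \sum_g f (v g) (X g).
Proof.
by move=> bf; rewrite linear_sum; apply: eq_bigr => g _; rewrite /= tliftE.
Qed.

Section Theory.
Variables (D : hopf_data H) (ev : G -> H -> F).
Hypothesis fa : function_algebra D ev.

Lemma idem_mul g h : v g * v h = (g == h)%:R *: v g.
Proof.
rewrite -[LHS](lcomb_ev fa) -{2}(lcomb_delta g) lcombZ; apply: eq_lcomb => l.
rewrite (ev_mul fa) !(ev_idem fa) eq_sym [in RHS]mulrC.
by have [->|_] := eqVneq l g; rewrite ?mul1r ?mul0r // eq_sym.
Qed.

Lemma sum_idem : \sum_g v g = 1.
Proof.
rewrite -(lcomb_ev fa 1); apply: eq_bigr => g _.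
by rewrite (ev_one fa) scale1r.
Qed.

Lemma lcomb1 : lcomb (fun=> 1) = 1.
Proof. by rewrite -sum_idem; apply: eq_bigr => g _; rewrite scale1r. Qed.

Lemma lcomb_inj x y : (forall g, ev g x = ev g y) -> x = y.
Proof.
by move=> E; rewrite -(lcomb_ev fa x) -(lcomb_ev fa y); apply: eq_lcomb.
Qed.

Lemma ev_lcomb g f : ev g (lcomb f) = f g.
Proof.
have e0 : ev g 0 = 0.
  by have := ev_linear fa g (-1) 0 0; rewrite scaler0 addr0 mulN1r addNr.
have -> : ev g (lcomb f) = \sum_h f h * ev g (v h).
  rewrite /lcomb; elim: (index_enum G) => [|h r IH]; first by rewrite !big_nil.
  by rewrite !big_cons (ev_linear fa) IH.
rewrite (bigD1 g) //= (ev_idem fa) eqxx mulr1 big1 ?addr0 // => h hg.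
by rewrite (ev_idem fa) (negbTE hg) mulr0.
Qed.

Lemma lcombM f1 f2 : lcomb f1 * lcomb f2 = lcomb (fun g => f1 g * f2 g).
Proof. by apply: lcomb_inj => g; rewrite (ev_mul fa) !ev_lcomb. Qed.

Lemma fa_mulC (x y : H) : x * y = y * x.
Proof. by apply: lcomb_inj => g; rewrite !(ev_mul fa) mulrC. Qed.

(** Orthogonality of the idempotents kills the cross terms. *)
Lemma colM (B : falgType F) (X Y : G -> B) :
  (\sum_g v g \ot X g) * (\sum_g v g \ot Y g) = \sum_g v g \ot (X g * Y g).
Proof.
rewrite mulr_suml; apply: eq_bigr => g _; rewrite mulr_sumr (bigD1 g) //=.
rewrite ptensM idem_mul eqxx scale1r big1 ?addr0 // => h hg.
by rewrite ptensM idem_mul eq_sym (negbTE hg) scale0r ptens0l.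
Qed.

Lemma tlcombM f1 f2 :
  tlcomb f1 * tlcomb f2 = tlcomb (fun g h => f1 g h * f2 g h).
Proof. by rewrite colM; apply: eq_bigr => g _; rewrite lcombM. Qed.

Lemma col_const (U : vectType F) (X : U) : \sum_g v g \ot X = 1 \ot X.
Proof. by rewrite -ptens_suml sum_idem. Qed.

Lemma tlcomb1 : tlcomb (fun _ _ => 1) = 1.
Proof. by rewrite /tlcomb lcomb1 col_const. Qed.

Lemma ptens_lcomb f1 f2 :
  lcomb f1 \ot lcomb f2 = tlcomb (fun g h => f1 g * f2 h).
Proof.
rewrite {1}/lcomb ptens_suml; apply: eq_bigr => g _.
by rewrite ptensZl -ptensZr lcombZ.
Qed.

Lemma tlcomb_unit f : (forall g h, f g h != 0) ->
  tlcomb f \is a GRing.unit /\ (tlcomb f)^-1 = tlcomb (fun g h => (f g h)^-1).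
Proof.
move=> f0.
have e1 : tlcomb f * tlcomb (fun g h => (f g h)^-1) = 1.
  by rewrite tlcombM -tlcomb1; apply: eq_tlcomb => g h; rewrite divff.
have e2 : tlcomb (fun g h => (f g h)^-1) * tlcomb f = 1.
  by rewrite tlcombM -tlcomb1; apply: eq_tlcomb => g h; rewrite mulVf.
have u : tlcomb f \is a GRing.unit.
  by apply/unitrP; exists (tlcomb (fun g h => (f g h)^-1)).
by split=> //; apply: (mulrI u); rewrite e1 divrr.
Qed.

Lemma tflip_tlcomb f : tflip (tlcomb f) = tlcomb (fun g h => f h g).
Proof.
rewrite /tflip tlift_tlcomb; last first.
  by case: (ptens_bilin H H).
by rewrite exchange_big tlcombE.
Qed.

Lemma comul_lcomb f : comul D (lcomb f) = tlcomb (fun g h => f (g * h)%g).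
Proof. by rewrite (fa_comul fa); apply: eq_tlcomb => g h; rewrite ev_lcomb. Qed.

Lemma antipode_idem h : antipode D (v h) = v h^-1%g.
Proof.
rewrite (fa_antipode fa) -(lcomb_delta h^-1%g); apply: eq_lcomb => g.
by rewrite (ev_idem fa) -(inj_eq invg_inj) invgK.
Qed.

Lemma comul_lin : linear (comul D).
Proof.
move=> a x y; rewrite !(fa_comul fa) tlcombP; apply: eq_tlcomb => g h.
by rewrite (ev_linear fa).
Qed.

Lemma antipode_lin : linear (antipode D).
Proof.
move=> a x y; rewrite !(fa_antipode fa) lcombP; apply: eq_lcomb => g.
by rewrite (ev_linear fa).
Qed.

Lemma counit_lin : scalar (counit D).
Proof. by move=> a x y; rewrite !(fa_counit fa) (ev_linear fa). Qed.

Lemma id_lin (U : vectType F) : linear (@id U). Proof. by []. Qed.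

Lemma tmap_id_comul f :
  tmap id (comul D) (tlcomb f) =
  \sum_g v g \ot tlcomb (fun h l => f g (h * l)%g).
Proof.
rewrite /tmap tlift_col; last first.
  exact: (bilin_comp (@id_lin _) (@id_lin _) comul_lin (@ptens_bilin _ _ _)).
by apply: eq_bigr => g _; rewrite comul_lcomb.
Qed.

Lemma tmap_comul_id f :
  tassoc (tmap (comul D) id (tlcomb f)) =
  \sum_g v g \ot tlcomb (fun h l => f (g * h)%g l).
Proof.
rewrite /tmap tlift_col; last first.
  exact: (bilin_comp (@id_lin _) comul_lin (@id_lin _) (@ptens_bilin _ _ _)).
have bt (w : H) : bilin (fun a b : H => a \ot (b \ot w)).
  apply: (@bilin_comp _ _ _ _ _ _ _ _ id id (fun b => b \ot w)) => //.
    exact: (proj1 (ptens_bilin H H)).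
  exact: ptens_bilin.
rewrite /tassoc linear_sum /=.
under eq_bigr => m _.
  rewrite tliftE; last first.
    split=> [w a x y|x a w w']; first exact: tlift_linear.
    apply: tlift_linear_fun => b c.
    by rewrite (proj2 (ptens_bilin _ _)) (proj2 (ptens_bilin _ _)).
  rewrite (fa_comul fa) tlift_tlcomb //.
  over.
rewrite exchange_big; apply: eq_bigr => g _ /=.
rewrite exchange_big ptens_sumr; apply: eq_bigr => h _.
(* The coefficient of v_g (x) v_h in the coproduct of v_m is 1 when m = gh and 0 otherwise, so a
   single [m] survives. *)
rewrite (bigD1 (g * h)%g) //= big1 => [|m mgh].
  by rewrite (ev_idem fa) eqxx scale1r addr0.
by rewrite (ev_idem fa) (negbTE mgh) scale0r.
Qed.

Lemma tlift_counit_l f :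
  tlift (fun a b => counit D a *: b) (tlcomb f) = lcomb (f 1%g).
Proof.
rewrite tlift_col; last exact: scalar_bilin counit_lin.
rewrite (bigD1 1%g) //= big1 ?addr0 => [|g g1].
  by rewrite (fa_counit fa) (ev_idem fa) eqxx scale1r.
by rewrite (fa_counit fa) (ev_idem fa) (negbTE g1) scale0r.
Qed.

Lemma tlift_counit_r f :
  tlift (fun a b => counit D b *: a) (tlcomb f) = lcomb (f^~ 1%g).
Proof.
rewrite tlift_col; last first.
  by case: (@scalar_bilin _ _ H _ counit_lin).
by apply: eq_bigr => g _; rewrite (fa_counit fa) ev_lcomb.
Qed.

Lemma tlift_antipode_l f :
  tlift (fun a b => antipode D a * b) (tlcomb f) =
  lcomb (fun g => f g^-1%g g).
Proof.
rewrite tlift_tlcomb; last first.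
  exact: (bilin_comp (@id_lin _) antipode_lin (@id_lin _) (mul_bilin H)).
rewrite exchange_big; apply: eq_bigr => h _ /=.
rewrite (bigD1 h^-1%g) //= antipode_idem invgK idem_mul eqxx scale1r.
rewrite big1 ?addr0 // => g gh.
rewrite antipode_idem idem_mul -(inj_eq invg_inj) invgK (negbTE gh).
by rewrite scale0r scaler0.
Qed.

Lemma tlift_antipode_r f :
  tlift (fun a b => a * antipode D b) (tlcomb f) =
  lcomb (fun g => f g g^-1%g).
Proof.
rewrite tlift_tlcomb; last first.
  exact: (bilin_comp (@id_lin _) (@id_lin _) antipode_lin (mul_bilin H)).
apply: eq_bigr => g _.
rewrite (bigD1 g^-1%g) //= antipode_idem invgK idem_mul eqxx scale1r.
rewrite big1 ?addr0 // => h hg.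
rewrite antipode_idem idem_mul -(inj_eq invg_inj) invgK eq_sym (negbTE hg).
by rewrite scale0r scaler0.
Qed.

(** Commutativity of [H] reduces this to [tlift_antipode_r]; the order of the product is that of the
    Drinfeld element. *)
Lemma tlift_antipode_flip f :
  tlift (fun a b => antipode D b * a) (tlcomb f) =
  lcomb (fun g => f g g^-1%g).
Proof.
rewrite -tlift_antipode_r; apply: eq_bigr => i _; apply: eq_bigr => j _.
by rewrite fa_mulC.
Qed.

Lemma lcomb_const a : lcomb (fun=> a) = a%:A.
Proof. by rewrite -lcomb1 lcombZ; apply: eq_lcomb => g; rewrite mulr1. Qed.

(** On functions, coassociativity, the counit axioms and the antipode axioms become the
    associativity, unit and inverse laws of [G]. *)
Lemma function_algebra_hopf : is_hopf D.
Proof.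
split=> [||||||| x|x|x|x|x].
- exact: comul_lin.
- move=> x y; rewrite !(fa_comul fa) tlcombM; apply: eq_tlcomb => g h.
  by rewrite (ev_mul fa).
- rewrite (fa_comul fa) -tlcomb1; apply: eq_tlcomb => g h.
  by rewrite (ev_one fa).
- exact: counit_lin.
- by move=> x y; rewrite !(fa_counit fa) (ev_mul fa).
- by rewrite (fa_counit fa) (ev_one fa).
- exact: antipode_lin.
- rewrite (fa_comul fa) tmap_comul_id tmap_id_comul; apply: eq_bigr => g _.
  by congr (_ \ot _); apply: eq_tlcomb => h l; rewrite mulgA.
- rewrite (fa_comul fa) tlift_counit_l -[RHS](lcomb_ev fa).
  by apply: eq_lcomb => g; rewrite mul1g.
- rewrite (fa_comul fa) tlift_counit_r -[RHS](lcomb_ev fa).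
  by apply: eq_lcomb => g; rewrite mulg1.
- rewrite (fa_comul fa) tlift_antipode_l (fa_counit fa) -lcomb_const.
  by apply: eq_lcomb => g; rewrite mulVg.
- rewrite (fa_comul fa) tlift_antipode_r (fa_counit fa) -lcomb_const.
  by apply: eq_lcomb => g; rewrite mulgV.
Qed.

Lemma leg12_tlcomb f :
  leg12 (tlcomb f) = \sum_g v g \ot tlcomb (fun h _ => f g h).
Proof.
rewrite /leg12 tlift_col; last first.
  apply: (bilin_comp (l := id) (p := id) (q := fun b => b \ot 1)) => //.
    exact: (proj1 (ptens_bilin H H)).
  exact: ptens_bilin.
apply: eq_bigr => g _; rewrite -lcomb1 ptens_lcomb; congr (_ \ot _).
by apply: eq_tlcomb => h l; rewrite mulr1.
Qed.

Lemma leg13_tlcomb f :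
  leg13 (tlcomb f) = \sum_g v g \ot tlcomb (fun _ l => f g l).
Proof.
rewrite /leg13 tlift_col; last first.
  apply: (bilin_comp (l := id) (p := id) (q := fun b => 1 \ot b)) => //.
    exact: (proj2 (ptens_bilin H H)).
  exact: ptens_bilin.
apply: eq_bigr => g _; rewrite -lcomb1 ptens_lcomb; congr (_ \ot _).
by apply: eq_tlcomb => h l; rewrite mul1r.
Qed.

Lemma leg23_tlcomb f : leg23 (tlcomb f) = \sum_g v g \ot tlcomb f.
Proof. by rewrite col_const. Qed.

(** Since [H] is commutative, conjugating by the twist preserves the coproduct and conjugating by Q
    preserves the antipode. *)
Lemma twist_tlcomb_function_algebra f : (forall g h, f g h != 0) ->
  function_algebra (twist D (tlcomb f)) ev.
Proof.
move=> f0; split; try by case: fa.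
  move=> x; have [_ /= ->] := tlcomb_unit f0.
  rewrite (fa_comul fa) !tlcombM; apply: eq_tlcomb => g h.
  by rewrite mulrAC mulVf ?mul1r.
move=> x /=; rewrite tlift_antipode_l -(fa_antipode fa).
rewrite fa_mulC mulrA divrr ?mul1r //.
(* Q is the function g -> f(g^-1, g), which vanishes nowhere. *)
have q1 : lcomb (fun g => f g^-1%g g) * lcomb (fun g => (f g^-1%g g)^-1) = 1.
  by rewrite lcombM -lcomb1; apply: eq_lcomb => g; rewrite divff.
apply/unitrP; exists (lcomb (fun g => (f g^-1%g g)^-1)).
by rewrite q1 fa_mulC q1.
Qed.

(** At v_g (x) v_h (x) v_l the twist equation reads f(gh,l) f(g,h) = f(g,hl) f(h,l); normalization
    gives the counit conditions. *)
Lemma is_twist_tlcomb f : normalized_2cocycle f -> is_twist D (tlcomb f).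
Proof.
case=> f0 fcoc f1; split.
- by case: (tlcomb_unit f0).
- rewrite tmap_comul_id leg12_tlcomb tmap_id_comul leg23_tlcomb !colM.
  apply: eq_bigr => g _; congr (_ \ot _); rewrite !tlcombM.
  by apply: eq_tlcomb => h l; rewrite mulrC fcoc mulrC.
- rewrite tlift_counit_l -lcomb1; apply: eq_lcomb => g.
  by case: (f1 g).
- rewrite tlift_counit_r -lcomb1; apply: eq_lcomb => g.
  by case: (f1 g).
Qed.

Lemma twistR_tlcomb f : (forall g h, f g h != 0) ->
  twistR (tlcomb f) = tlcomb (fun g h => f g h / f h g).
Proof.
move=> f0; rewrite /twistR tflip_tlcomb.
have [|_ ->] := @tlcomb_unit (fun g h => f h g); first by [].
by rewrite tlcombM; apply: eq_tlcomb => g h; rewrite mulrC.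
Qed.

(** The two coproduct identities for R are multiplicativity of [b] in each variable, the condition
    on the opposite coproduct is commutativity of [G], and R_21 = R^-1 is skewness. *)
Lemma triangular_tlcomb (b : commfactor F G) : abelian [set: G] ->
  is_triangular D (tlcomb b).
Proof.
move=> abG; have [ub bV] := tlcomb_unit (commfactor_neq0 b).
split=> //.
- exact: function_algebra_hopf.
- rewrite tmap_comul_id leg13_tlcomb leg23_tlcomb colM.
  apply: eq_bigr => g _; rewrite tlcombM; congr (_ \ot _).
  by apply: eq_tlcomb => h l; rewrite commfactor_mull.
- rewrite tmap_id_comul leg13_tlcomb leg12_tlcomb colM.
  apply: eq_bigr => g _; rewrite tlcombM; congr (_ \ot _).
  by apply: eq_tlcomb => h l; rewrite commfactor_mulr mulrC.
- move=> x; rewrite bV (fa_comul fa) tflip_tlcomb !tlcombM.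
  apply: eq_tlcomb => g h; rewrite mulrAC divff ?commfactor_neq0 // mul1r.
  by rewrite (centsP abG h _ g) ?inE.
- rewrite bV tflip_tlcomb; apply: eq_tlcomb => g h.
  apply: (mulfI (commfactor_neq0 b g h)).
  by rewrite commfactor_skew divff ?commfactor_neq0.
Qed.

Lemma Rtilde_tlcomb (b : commfactor F G) (u := fun g => b g g) :
  Rtilde D (tlcomb b) =
  tlcomb (fun g h => b g h * (2^-1 * (1 + u h + u g - u g * u h))).
Proof.
rewrite /Rtilde /Ru /drinfeld tlift_antipode_flip.
(* b(g,g^-1) is the inverse of b(g,g), which squares to 1 by skewness; so the Drinfeld element is g
   -> b(g,g). *)
have -> : lcomb (fun g => b g g^-1%g) = lcomb u.
  apply: eq_lcomb => g; apply: (mulfI (commfactor_neq0 b g g)).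
  rewrite -commfactor_mulr mulgV commfactor_skew.
  apply: (mulfI (commfactor_neq0 b g 1%g)).
  by rewrite -commfactor_mulr mulg1 mulr1.
rewrite -lcomb1 !ptens_lcomb !tlcombD addrC -scaleN1r tlcombP tlcombZ tlcombM.
by apply: eq_tlcomb => g h; rewrite !mul1r mulr1 mulN1r addrC.
Qed.

(* Slicing the first tensor factor of R with the coordinate at z puts
   \sum_h b z h *: v h in B; orthogonality then recovers each v h. *)
Lemma tlcomb_sub_full (b : commfactor F G) (B : {vspace H}) :
  #|G|%:R != 0 :> F -> (forall g, g != 1%g -> exists h, b h g != 1) ->
  tlcomb b \in tensorv B B -> B = fullv.
Proof.
move=> cG0 nondeg bB.
have slice z : lcomb (b z) \in B.
  pose s := tlift (fun x y => ev z x *: y) : tensor H H -> H.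
  have bs : bilin (fun x (y : H) => ev z x *: y).
    exact: scalar_bilin (ev_linear fa z).
  have -> : lcomb (b z) = s (tlcomb b).
    rewrite /s tlift_col // (bigD1 z) //= (ev_idem fa) eqxx scale1r.
    by rewrite big1 ?addr0 // => g gz; rewrite (ev_idem fa) (negbTE gz) scale0r.
  (* Writing [tensorv B B] as a span expresses R through x (x) y with x, y in a basis of [B]; each
     slice is a multiple of y. *)
  have bB' : tlcomb b \in
      <<in_tuple [seq x \ot y | x <- vbasis B, y <- vbasis B]>>%VS by [].
  rewrite /s (coord_span bB') linear_sum; apply: rpred_sum => i _.
  rewrite linearZ; apply: rpredZ.
  have /allpairsP[[x y] [/= xB yB ->]] := mem_nth 0 (ltn_ord i).
  by rewrite tliftE //; apply: rpredZ; apply: vbasis_mem.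
apply/eqP; rewrite eqEsubv subvf; apply/subvP=> x _.
rewrite -(lcomb_ev fa x); apply: rpred_sum => y _; apply: rpredZ.
(* Fourier inversion for [b]: the coefficient at g is the mean over z of b(z, y^-1 g), which is 1 if
   g = y and 0 otherwise by non-degeneracy. *)
have <- : #|G|%:R^-1 *: (\sum_z b z y^-1%g *: lcomb (b z)) = v y.
  rewrite sum_lcomb lcombZ -(lcomb_delta y); apply: eq_lcomb => g.
  under eq_bigr => z _ do rewrite -commfactor_mulr.
  have [<-|yg] := eqVneq y g.
    have b1 z : b z (y^-1 * y)%g = 1.
      apply: (mulfI (commfactor_neq0 b z y)).
      by rewrite -commfactor_mulr mulVg mulg1 mulr1.
    by under eq_bigr => z _ do rewrite b1; rewrite sumr_const mulVf.
  have [|z bz] := nondeg (y^-1 * g)%g; first by rewrite -eq_mulVg1.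
  rewrite (sum_multiplicative (f := fun z => b z (y^-1 * g)%g) _ bz) ?mulr0 //.
  by move=> z1 z2; rewrite commfactor_mull.
by apply: rpredZ; apply: rpred_sum => z _; apply: rpredZ.
Qed.

End Theory.
End FunctionAlgebra.

(** * Fourier inversion for a pairing of two finite groups *)

Section PerfectPairing.
Variables (k : fieldType) (X Y : finGroupType) (p : X -> Y -> k).

(** Common setting for the pairings of A with G and of K with G'. Separation on each side yields the
    two orthogonality relations. *)
Record perfect_pairing : Prop := PerfectPairing {
  pairing_mull : forall y, {morph p^~ y : a b / (a * b)%g >-> a * b};
  pairing_mulr : forall a, {morph p a : x y / (x * y)%g >-> x * y};
  pairing_neq0 : forall a y, p a y != 0;
  pairing_sepl : forall a, a != 1%g -> exists y, p a y != 1;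
  pairing_sepr : forall y, y != 1%g -> exists a, p a y != 1
}.

(** The Fourier transform of [x], evaluated at [y]. *)
Definition pairing_ev (y : Y) (x : grpalg k X) : k := \sum_a x a * p a y.

(** The inverse transform of the delta function at [y]; convertible to [vvec] and [vquo] for the two
    pairings. *)
Definition pairing_idem (y : Y) : grpalg k X :=
  #|Y|%:R^-1 *: \sum_a p a y^-1%g *: gbase a.

Hypotheses (pp : perfect_pairing) (cY0 : #|Y|%:R != 0 :> k).

Lemma pairing_1l y : p 1%g y = 1.
Proof.
apply: (mulfI (pairing_neq0 pp 1%g y)).
by rewrite -(pairing_mull pp) mulg1 mulr1.
Qed.

Lemma pairing_1r a : p a 1%g = 1.
Proof.
apply: (mulfI (pairing_neq0 pp a 1%g)).
by rewrite -(pairing_mulr pp) mulg1 mulr1.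
Qed.

Lemma pairing_Vl a y : p a^-1%g y = p a y^-1%g.
Proof.
apply: (mulfI (pairing_neq0 pp a y)).
by rewrite -(pairing_mull pp) -(pairing_mulr pp) !mulgV pairing_1l pairing_1r.
Qed.

Lemma sum_pairing_r a : \sum_y p a y = #|Y|%:R *+ (a == 1%g).
Proof.
have [->|/(pairing_sepl pp)[y pay]] := eqVneq a 1%g.
  by under eq_bigr => y _ do rewrite pairing_1l; rewrite sumr_const.
exact: sum_multiplicative (pairing_mulr pp a) pay.
Qed.

Lemma sum_pairing_l y : \sum_a p a y = #|X|%:R *+ (y == 1%g).
Proof.
have [->|/(pairing_sepr pp)[a pay]] := eqVneq y 1%g.
  by under eq_bigr => a _ do rewrite pairing_1r; rewrite sumr_const.
exact: (sum_multiplicative (f := p^~ y) (pairing_mull pp y) pay).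
Qed.

(** Summing [p] over both variables, in either order, leaves only the term at 1. This reconciles the
    factor |Y|^-1 in [pairing_idem] with sums over [X]. *)
Lemma pairing_card : #|X|%:R = #|Y|%:R :> k.
Proof.
have <- : \sum_y \sum_a p a y = #|X|%:R.
  under eq_bigr => y _ do rewrite sum_pairing_l.
  by rewrite (bigD1 1%g) //= eqxx big1 ?addr0 // => y /negbTE->.
rewrite exchange_big /=; under eq_bigr => a _ do rewrite sum_pairing_r.
by rewrite (bigD1 1%g) //= eqxx big1 ?addr0 // => a /negbTE->.
Qed.

Lemma gbase_sumE (c : X -> k) b :
  (\sum_a c a *: gbase a : grpalg k X) b = c b.
Proof.
rewrite sum_ffunE (bigD1 b) //= !ffunE eqxx [_ *: _]mulr1.
by rewrite big1 ?addr0 // => a /negbTE ab; rewrite !ffunE eq_sym ab [LHS]mulr0.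
Qed.

Lemma grpalg_sum (x : grpalg k X) : x = \sum_a x a *: gbase a.
Proof. by apply/ffunP=> b; rewrite gbase_sumE. Qed.

(** Fourier inversion: the coefficient at b on the right is the mean over y of p(a b^-1, y), which
    is 1 for b = a and 0 otherwise. *)
Lemma gbase_lcomb a : gbase a = lcomb pairing_idem (p a).
Proof.
have -> : lcomb pairing_idem (p a) =
    \sum_b (#|Y|%:R^-1 * \sum_y p (a * b^-1)%g y) *: gbase b.
  rewrite /lcomb /pairing_idem; under eq_bigr => y _ do
    rewrite scalerA mulrC -scalerA scaler_sumr.
  rewrite -scaler_sumr exchange_big scaler_sumr; apply: eq_bigr => b _ /=.
  rewrite -scalerA; congr (_ *: _); rewrite scaler_suml; apply: eq_bigr => y _.
  by rewrite scalerA (pairing_mull pp) pairing_Vl.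
rewrite (bigD1 a) //= sum_pairing_r mulgV eqxx mulVf // scale1r.
rewrite big1 ?addr0 // => b ba; rewrite sum_pairing_r -eq_mulgV1.
by rewrite eq_sym (negbTE ba) mulr0 scale0r.
Qed.

Lemma pairing_ev_gbase y a : pairing_ev y (gbase a) = p a y.
Proof.
rewrite /pairing_ev (bigD1 a) //= ffunE eqxx mul1r big1 ?addr0 // => b ba.
by rewrite ffunE (negbTE ba) mul0r.
Qed.

Lemma pairing_ev_linear y : scalar (pairing_ev y).
Proof.
move=> c x x'; rewrite /pairing_ev mulr_sumr -big_split; apply: eq_bigr => a _.
by rewrite !ffunE /= mulrDl -mulrA.
Qed.

(** Coproduct, counit and antipode are compared on the group elements [gbase a], that is on the
    characters p(a, .), where they reduce to multiplicativity of p. *)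
Lemma pairing_function_algebra :
  function_algebra pairing_idem (grp_hopf k X) pairing_ev.
Proof.
split.
- exact: pairing_ev_linear.
- move=> y x x'; rewrite [RHS]mulr_suml /pairing_ev.
  under eq_bigr => a _ do rewrite ffunE mulr_suml.
  rewrite exchange_big; apply: eq_bigr => b _ /=.
  rewrite mulr_sumr (reindex_inj (mulgI b)); apply: eq_bigr => c _ /=.
  by rewrite mulKg (pairing_mull pp) mulrACA.
- by move=> y; rewrite pairing_ev_gbase pairing_1l.
- move=> g h; rewrite /pairing_ev /pairing_idem.
  under eq_bigr => a _.
    rewrite ffunE gbase_sumE -[_ *: _]/(_ * _) -mulrA -(pairing_mulr pp); over.
  rewrite -mulr_sumr sum_pairing_l pairing_card -eq_mulVg1.
  by case: (h == g); rewrite ?mulVf ?mulr0.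
- move=> x; rewrite /pairing_ev -sum_lcomb [RHS]grpalg_sum.
  by apply: eq_bigr => a _; rewrite -gbase_lcomb.
- move=> x; rewrite /pairing_ev -sum_tlcomb /=; apply: eq_bigr => a _.
  rewrite gbase_lcomb ptens_lcomb; congr (_ *: _).
  by apply: eq_tlcomb => g h; rewrite (pairing_mulr pp).
- by move=> x; apply: eq_bigr => a _; rewrite pairing_1r mulr1.
- move=> x; rewrite /pairing_ev -sum_lcomb /=; apply: eq_bigr => a _.
  rewrite gbase_lcomb; congr (_ *: _).
  by apply: eq_lcomb => g; rewrite pairing_Vl.
Qed.

End PerfectPairing.

(** * The pairings of G with A and of G' with K *)

Section CharacterPairings.
Variables (k : closedFieldType) (G : finGroupType) (beta : commfactor k G).
Hypotheses (char0 : [pchar k] =i pred0) (abG : abelian [set: G]).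

Lemma khom_pairing : perfect_pairing (@khom_app k G).
Proof.
split.
- by move=> y a b; apply: khom_mulE.
- by move=> a x y; apply: khomM.
- exact: khom_neq0.
- move=> a a1; apply/existsP; apply: contraNT a1 => /existsPn a1.
  apply/eqP; apply/khomP=> x; rewrite khom_oneE; exact/eqP/negbNE/a1.
- by move=> y y1; apply: khom_separates.
Qed.

(** Reduces statements on G' to cosets of elements of G, where [betaquo] and [Kapp] have explicit
    values. *)
Lemma quoG_ind (P : quoG beta -> Prop) :
  (forall g, P (coset (kerchi beta) g)) -> forall x, P x.
Proof. by move=> Pc x; rewrite -(coset_reprK x). Qed.

Lemma coset_kerM g h :
  coset (kerchi beta) (g * h)%g =
  (coset (kerchi beta) g * coset (kerchi beta) h)%g :> quoG beta.
Proof. by rewrite morphM ?ker_chi_norm. Qed.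

Lemma betaquo_chi g h :
  betaquo (coset (kerchi beta) g) (coset (kerchi beta) h) = betakappa beta g h.
Proof. exact: betaquoE. Qed.

(** By skewness the kernel of chi is the radical on either side. These characters separate the
    points of G'. *)
Lemma chi_K g : chi beta g \in K beta.
Proof.
rewrite inE; apply/forall_inP=> l kl.
by rewrite chiE (proj2 (ker_chiE g kl)).
Qed.

Lemma betaquo_nondegenerate (x : quoG beta) : x != 1%g ->
  exists y, betaquo y x != 1.
Proof.
elim/quoG_ind: x => g g1.
suff /existsP[h hg] : [exists h, betakappa beta h g != 1].
  by exists (coset (kerchi beta) h); rewrite betaquo_chi.
(* If g pairs trivially with every h on the left, skewness exchanges the arguments and puts g in the
   kernel of chi. *)
apply: contraNT g1 => /existsPn b1; apply/eqP/coset_id.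
apply/(kerP (chi_morphism beta) (in_setT g)); apply/khomP=> h.
rewrite chiE khom_oneE.
have /eqP bhg := negPn (b1 h).
by rewrite -[LHS]mul1r -bhg (commfactor_skew (betakappa beta)).
Qed.

Lemma Kapp_pairing : perfect_pairing (@Kapp k G beta).
Proof.
split.
- by move=> y a b; rewrite /Kapp /= khom_mulE.
- move=> a; elim/quoG_ind=> g; elim/quoG_ind=> h.
  by rewrite -coset_kerM !KappE khomM.
- by move=> a y; apply: khom_neq0.
- move=> a a1; apply/existsP; apply: contraNT a1 => /existsPn a1.
  apply/eqP/val_inj; apply/khomP=> g /=; rewrite khom_oneE -KappE.
  exact/eqP/negbNE/a1.
(* Non-degeneracy provides h pairing non-trivially with x, and chi_h is the separating element of
   K. *)
- move=> x /betaquo_nondegenerate[y]; elim/quoG_ind: y => h.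
  elim/quoG_ind: x => g bhg; exists (subg (K beta) (chi beta h)).
  by rewrite KappE subgK ?chi_K // chiE -betaquo_chi.
Qed.

Fact betaquo_mull (x y z : quoG beta) :
  betaquo (x * y)%g z = betaquo x z * betaquo y z.
Proof.
elim/quoG_ind: x => g; elim/quoG_ind: y => h; elim/quoG_ind: z => l.
by rewrite -coset_kerM !betaquo_chi commfactor_mull.
Qed.

Fact betaquo_mulr (x y z : quoG beta) :
  betaquo x (y * z)%g = betaquo x y * betaquo x z.
Proof.
elim/quoG_ind: x => g; elim/quoG_ind: y => h; elim/quoG_ind: z => l.
by rewrite -coset_kerM !betaquo_chi commfactor_mulr.
Qed.

Fact betaquo_skew (x y : quoG beta) : betaquo x y * betaquo y x = 1.
Proof.
elim/quoG_ind: x => g; elim/quoG_ind: y => h.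
by rewrite !betaquo_chi commfactor_skew.
Qed.

Definition betaquo_factor : commfactor k (quoG beta) :=
  CommFactor betaquo_mull betaquo_mulr betaquo_skew.

Lemma quoG_abelian : abelian [set: quoG beta].
Proof.
apply/centsP; elim/quoG_ind=> g _; elim/quoG_ind=> h _.
by rewrite /commute -!coset_kerM (centsP abG g _ h) ?inE.
Qed.

Lemma card_quoG_neq0 : #|quoG beta|%:R != 0 :> k.
Proof. by rewrite natf_neq0_char0 // -cardsT cardG_gt0. Qed.

Lemma card_G_neq0 : #|G|%:R != 0 :> k.
Proof. by rewrite natf_neq0_char0 // -cardsT cardG_gt0. Qed.

Lemma vvec_function_algebra :
  function_algebra (@vvec k G) (grp_hopf k (khom k G))
    (pairing_ev (@khom_app k G)).
Proof. exact: pairing_function_algebra khom_pairing card_G_neq0. Qed.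

Lemma vquo_function_algebra :
  function_algebra (@vquo k G beta) (grp_hopf k (subg_of (K beta)))
    (pairing_ev (@Kapp k G beta)).
Proof. exact: pairing_function_algebra Kapp_pairing card_quoG_neq0. Qed.

(** The value of R_u at (g,h), checked on the four sign patterns of u; characteristic 0 separates 1
    from -1 and inverts 2. *)
Lemma kappaE g h : 2^-1 * (1 + beta h h + beta g g - beta g g * beta h h) =
  kappa beta g h.
Proof.
have n2 : 2 != 0 :> k by rewrite natf_neq0_char0.
have n1 : 1 != -1 :> k by rewrite -subr_eq0 opprK.
rewrite /kappa -!/(ufun beta _).
case: (ufun_pm1 beta g) (ufun_pm1 beta h) => -> [] ->;
  rewrite ?eqxx ?(negbTE n1) /= ?mulrNN ?mulr1 ?mul1r.
- by rewrite addrK -[1 + 1]/2 mulVf.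
- by rewrite subrr add0r opprK mulVf.
- by rewrite addrK mulVf.
by rewrite subrr add0r -opprD mulrN mulVf.
Qed.

(** On functions the inclusion is pullback along G -> G', since an element of K takes the same value
    at g and at its coset. *)
Lemma grpalg_incl_lcomb x :
  grpalg_incl (K := K beta) x =
  lcomb (@vvec k G)
    (fun g => pairing_ev (@Kapp k G beta) (coset (kerchi beta) g) x).
Proof.
rewrite /pairing_ev -sum_lcomb; apply: eq_bigr => a _.
rewrite (gbase_lcomb khom_pairing card_G_neq0); congr (_ *: _).
by apply: eq_lcomb => g; rewrite KappE.
Qed.

Lemma grpalg_incl_Jquo gamma :
  tmap (@grpalg_incl k _ (K beta)) (@grpalg_incl k _ (K beta)) (Jquo gamma) =
  tlcomb (@vvec k G)
    (fun g h => gamma (coset (kerchi beta) g) (coset (kerchi beta) h)).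
Proof.
have incl_lin : linear (@grpalg_incl k _ (K beta)).
  move=> c x y; rewrite !grpalg_incl_lcomb lcombP; apply: eq_lcomb => g.
  exact: pairing_ev_linear.
have fq := vquo_function_algebra.
rewrite /Jquo -tlcombE /tmap tlift_tlcomb; last first.
  exact: (bilin_comp (@id_lin _ _) incl_lin incl_lin (@ptens_bilin _ _ _)).
under eq_bigr => x _.
  under eq_bigr => y _ do rewrite !grpalg_incl_lcomb ptens_lcomb.
  rewrite sum_tlcomb -[tlcomb _ _]scale1r; over.
rewrite sum_tlcomb; apply: eq_tlcomb => g h.
(* [vquo x] pulls back to the indicator function of the coset [x], so only the cosets of g and h
   contribute. *)
rewrite (bigD1 (coset (kerchi beta) g)) //= [X in _ + X]big1 => [|x xg].
  rewrite addr0 mul1r (bigD1 (coset (kerchi beta) h)) //= big1 => [|y yh].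
    by rewrite !(ev_idem fq) !eqxx !mulr1 addr0.
  by rewrite !(ev_idem fq) (negbTE yh) !mulr0.
rewrite mul1r big1 // => y _.
by rewrite (ev_idem fq) (negbTE xg) mul0r mulr0.
Qed.

End CharacterPairings.

(** * The minimal twist and the isomorphism of triangular Hopf algebras *)

Theorem theorem1p6 (k : closedFieldType) (k_char0 : [pchar k] =i pred0)
    (G : finGroupType) (G_abelian : abelian [set: G]) (beta : commfactor k G)
    (gamma : quoG beta -> quoG beta -> k)
    (gamma_cocycle : normalized_2cocycle gamma)
    (gamma_beta : forall x y : quoG beta,
      betaquo x y = gamma x y / gamma y x) :
  etingof_gelaki_data (grp_hopf k (khom k G)) (Rbeta beta)
    (khom k G) (K beta) (Jquo gamma).
Proof.
have [gamma0 _ _] := gamma_cocycle.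
have fq := vquo_function_algebra beta k_char0.
have fv := vvec_function_algebra k_char0 G_abelian.
have JE : Jquo gamma = tlcomb (@vquo k G beta) gamma by rewrite tlcombE.
have RE : Rbeta beta = tlcomb (@vvec k G) beta by rewrite tlcombE.
rewrite /etingof_gelaki_data grpalg_incl_Jquo // JE RE; split.
  (* The twisted k[K] is still the function algebra of G', now with R-matrix beta', whose
     non-degeneracy gives minimality. *)
  have fJ := twist_tlcomb_function_algebra fq gamma0.
  have RJE : twistR (tlcomb (@vquo k G beta) gamma) =
      tlcomb (@vquo k G beta) (betaquo_factor beta).
    apply: etrans (twistR_tlcomb fq gamma0) _.
    by apply: eq_tlcomb => x y; rewrite -gamma_beta.
  split; first exact: (is_twist_tlcomb fq gamma_cocycle).
  rewrite RJE; split.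
    exact: (triangular_tlcomb fJ _ (quoG_abelian _ G_abelian)).
  move=> B _; apply: (tlcomb_sub_full fJ).
    exact: card_quoG_neq0.
  exact: betaquo_nondegenerate.
have gammac0 g h :
    gamma (coset (kerchi beta) g) (coset (kerchi beta) h) != 0 by [].
have fJ := twist_tlcomb_function_algebra fv gammac0.
(* R_u contributes the factor [kappa]. *)
have RtE : Rtilde (grp_hopf k (khom k G)) (tlcomb (@vvec k G) beta) =
    tlcomb (@vvec k G) (betakappa beta).
  by rewrite (Rtilde_tlcomb fv); apply: eq_tlcomb => g h; rewrite kappaE.
(* The quotient of gamma by its transpose is beta', which pulls back to beta kappa on G. *)
have RJE : twistR (tlcomb (@vvec k G) (fun g h =>
    gamma (coset (kerchi beta) g) (coset (kerchi beta) h))) =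
    tlcomb (@vvec k G) (betakappa beta).
  apply: etrans (twistR_tlcomb fv gammac0) _; apply: eq_tlcomb => g h.
  by rewrite -gamma_beta betaquo_chi.
have tmap_id (X : tensor (grpalg k (khom k G)) (grpalg k (khom k G))) :
    tmap idfun idfun X = X.
  by rewrite [RHS]tensor_sum.
rewrite RtE RJE; split.
- exact: (triangular_tlcomb fv _ G_abelian).
- exact: (triangular_tlcomb fJ _ G_abelian).
(* Both Hopf structures on k[A] are given by the same formulas in the same evaluations, so the
   identity respects them. *)
exists idfun; last exact: tmap_id.
split.
- by exists id.
- move=> x; rewrite tmap_id.
  exact: etrans (fa_comul fJ x) (esym (fa_comul fv x)).
- by [].
by move=> x; rewrite (fa_antipode fJ) (fa_antipode fv).
Qed.
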